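(* 1) Let $R$ be a ring and let $A$ be a subring retract of $R$. If $R$ is a Gaussian ring, then $A$ is a Gaussian ring. 2) Let $(A,M)$ be a local ring with maximal ideal $M$, and let $R := A \propto (A/M)$ be the trivial ring extension of $A$ by the $A$-module $A/M$. Then $R$ is a Gaussian ring if and only if $A$ is a Gaussian ring.
   Context: All rings are commutative with identity and all modules are unital. A local ring is a ring with a unique maximal ideal (not assumed Noetherian). Subring retract: for rings $A \subseteq R$ ($A$ a subring of $R$), $A$ is a subring retract (or module retract) of $R$ if there is an $A$-module homomorphism $\phi : R \to A$ with $\phi(a) = a$ for all $a \in A$ ($\phi$ need not be a ring homomorphism). Such a $\phi$ is called a module retraction map. Gaussian ring: for a polynomial $f \in R[X]$, the content $C_R(f)$ is the ideal of $R$ generated by the coefficients of $f$. The ring $R$ is Gaussian if $C_R(fg) = C_R(f)C_R(g)$ for all $f, g \in R[X]$. Trivial ring extension: for a ring $A$ and an $A$-module $E$, $A \propto E$ is the set of pairs $(a,e)$ with $a \in A$, $e \in E$, with coordinatewise addition and multiplication $(a,e)(a',e') = (aa', ae' + a'e)$. $A$ is regarded as a subring via $a \mapsto (a,0)$. *)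

(* Defs.v *)
From HB Require Import structures.
From mathcomp Require Import all_boot all_algebra.
From mathcomp Require Import boolp classical_sets.

Set Implicit Arguments.
Unset Strict Implicit.
Unset Printing Implicit Defensive.

Import GRing.Theory.
Local Open Scope ring_scope.
Local Open Scope classical_set_scope.

(** * Ideals *)

Section Ideals.
Variable R : comNzRingType.
Implicit Types I J : set R.

(* Unlike MathComp's [idealr], the unit ideal is allowed: contents of
   polynomials need not be proper. *)
Definition is_ideal I : Prop :=
  [/\ I 0,
      forall x y, I x -> I y -> I (x + y)
    & forall a x, I x -> I (a * x)].

Definition ideal_gen (S : set R) : set R := smallest is_ideal S.

Definition ideal_mul I J : set R := ideal_gen [set x * y | x in I & y in J].

Definition maximal_ideal I : Prop :=
  [/\ is_ideal I, I != setT
    & forall J, is_ideal J -> I `<=` J -> J = I \/ J = setT].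

End Ideals.

Definition local_ring (A : comNzRingType) (M : idealr A) : Prop :=
  maximal_ideal [set` M] /\ forall J, maximal_ideal J -> J = [set` M].

(** * Gaussian rings *)

Definition content (R : comNzRingType) (f : {poly R}) : set R :=
  ideal_gen [set` (f : seq R)].

Definition gaussian (R : comNzRingType) : Prop :=
  forall f g : {poly R}, content (f * g) = ideal_mul (content f) (content g).

(** * Subring retracts *)

(* The subring is given as a [subComNzRingType P], whose projection [val] into
   [R] is a ring morphism with image [P]; [R] is an [A]-module through it. *)
Definition module_retraction (R : comNzRingType) (P : {pred R})
    (A : subComNzRingType P) (phi : R -> A) : Prop :=
  [/\ forall x y, phi (x + y) = phi x + phi y,
      forall a x, phi (val a * x) = a * phi x
    & forall a, phi (val a) = a].

Definition subring_retract (R : comNzRingType) (P : {pred R})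
    (A : subComNzRingType P) : Prop :=
  exists phi : R -> A, module_retraction phi.

(** * The [A]-module [A / I] *)

Section QuotientModule.
Variables (A : comNzRingType) (I : idealr A).
Local Notation Q := {ideal_quot I}.

Definition quot_scale (a : A) (x : Q) : Q := \pi_Q%qT a * x.

Fact quot_scaleA a b x : quot_scale a (quot_scale b x) = quot_scale (a * b) x.
Proof. by rewrite /quot_scale mulrA -rmorphM. Qed.

Fact quot_scale1 : left_id 1 quot_scale.
Proof. by move=> x; rewrite /quot_scale rmorph1 mul1r. Qed.

Fact quot_scaleDr : right_distributive quot_scale +%R.
Proof. by move=> a x y; rewrite /quot_scale mulrDr. Qed.

Fact quot_scaleDl x : {morph quot_scale^~ x : a b / a + b}.
Proof. by move=> a b; rewrite /quot_scale rmorphD mulrDl. Qed.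

HB.instance Definition _ := GRing.Zmodule_isLmodule.Build A Q
  quot_scaleA quot_scale1 quot_scaleDr quot_scaleDl.

End QuotientModule.

(** * Trivial ring extensions *)

(* An alias of [A * E], so that it does not inherit the componentwise
   multiplication when [E] happens to be a ring (as [A / M] is). *)
Definition triv_ext (A : comNzRingType) (E : lmodType A) : Type := (A * E)%type.

Section TrivExt.
Variables (A : comNzRingType) (E : lmodType A).
Local Notation T := (triv_ext E).

HB.instance Definition _ := GRing.Zmodule.copy T (A * E)%type.

Definition triv_ext_one : T := (1, 0).

Definition triv_ext_mul (x y : T) : T :=
  (x.1 * y.1, x.1 *: y.2 + y.1 *: x.2).

Fact triv_ext_mulA : associative triv_ext_mul.
Proof.
move=> x y z; rewrite /triv_ext_mul /= mulrA !scalerDr !scalerA addrA.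
by rewrite [z.1 * x.1]mulrC [z.1 * y.1]mulrC.
Qed.

Fact triv_ext_mulC : commutative triv_ext_mul.
Proof. by move=> x y; rewrite /triv_ext_mul mulrC addrC. Qed.

Fact triv_ext_mul1 : left_id triv_ext_one triv_ext_mul.
Proof.
by case=> a e; rewrite /triv_ext_mul /= mul1r scale1r scaler0 addr0.
Qed.

Fact triv_ext_mulDl : left_distributive triv_ext_mul +%R.
Proof.
move=> x y z; rewrite /triv_ext_mul /=; congr pair; first by rewrite mulrDl.
by rewrite /= scalerDl scalerDr addrACA.
Qed.

Fact triv_ext_one_neq0 : triv_ext_one != 0.
Proof. by apply/eqP => -[] /eqP; rewrite oner_eq0. Qed.

HB.instance Definition _ := GRing.Zmodule_isComNzRing.Build T
  triv_ext_mulA triv_ext_mulC triv_ext_mul1 triv_ext_mulDl triv_ext_one_neq0.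

End TrivExt.

(* Main.v *)
(** The ring [R] is Gaussian iff every product [f`_i * g`_j] lies in the content
    of [f * g], and this membership is transported by module retractions.  The
    trivial extension retracts onto [A], so only the converse in 2) is left.  If
    no coefficient of [F] or [G] is a unit, their first components kill [A / M],
    so [F * G] is the image of a product over [A].  If some coefficient of [F] is
    a unit, then the coefficients of [G] lie in the content of [F * G]: in any
    commutative ring, if the coefficients of [F * G] lie in an ideal [J], then so
    do all [F`_i ^+ N * G`_j] for [N] large. *)
Require Import Defs.
From HB Require Import structures.
From mathcomp Require Import all_boot all_algebra.
From mathcomp Require Import boolp classical_sets.

Set Implicit Arguments.
Unset Strict Implicit.
Unset Printing Implicit Defensive.

Import GRing.Theory.
Local Open Scope ring_scope.
Local Open Scope classical_set_scope.

(** * Ideals and contents of polynomials *)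

Section Ideals.
Variable R : comNzRingType.
Implicit Types (I J S : set R) (f g : {poly R}).

Lemma ideal_gen_ideal S : is_ideal (ideal_gen S).
Proof.
split=> [J [[J0 _ _] _] //|x y Sx Sy J JS|a x Sx J JS].
  by have [[_ JD _] _] := JS; apply: JD; [exact: Sx|exact: Sy].
by have [[_ _ JM] _] := JS; apply: JM; exact: Sx.
Qed.

Lemma ideal_sum J (I : Type) (r : seq I) (P : pred I) (F : I -> R) :
  is_ideal J -> (forall i, P i -> J (F i)) -> J (\sum_(i <- r | P i) F i).
Proof. by case=> J0 JD _ JF; elim/big_ind: _. Qed.

Lemma ideal_sub J x y : is_ideal J -> J x -> J y -> J (x - y).
Proof.
by case=> _ JD JM Jx Jy; apply: JD => //; rewrite -mulN1r; exact: JM.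
Qed.

Lemma content_ideal f : is_ideal (content f).
Proof. exact: ideal_gen_ideal. Qed.

Lemma content_coef f i : content f f`_i.
Proof.
have [i_lt|i_ge] := ltnP i (size f).
  by apply: sub_gen_smallest; exact: mem_nth.
by rewrite nth_default //; have [] := content_ideal f.
Qed.

Lemma content_sub J f :
  is_ideal J -> (forall i, J f`_i) -> content f `<=` J.
Proof.
move=> idJ Jf; apply: smallest_sub => // x /= /(nthP 0)[i _ <-].
exact: Jf.
Qed.

Lemma ideal_mul_mem I J x y : I x -> J y -> ideal_mul I J (x * y).
Proof. by move=> Ix Jy; apply: sub_gen_smallest; exists x => //; exists y. Qed.

Lemma gaussianP :
  gaussian R <-> forall f g i j, content (f * g) (f`_i * g`_j).
Proof.
split=> [gaussR f g i j|H f g].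
  by rewrite gaussR; apply: ideal_mul_mem; exact: content_coef.
have [_ _ cM] := content_ideal (f * g).
rewrite eqEsubset; split.
  apply: content_sub => [|k]; first exact: ideal_gen_ideal.
  rewrite coefM; apply: ideal_sum => [|l _]; first exact: ideal_gen_ideal.
  by apply: ideal_mul_mem; exact: content_coef.
apply: smallest_sub; first exact: content_ideal.
(* With one factor fixed, the elements whose product with it lies in [content (f * g)] form a colon
   ideal. Testing coefficients, first of [g] and then of [f], is therefore enough. *)
suff sub i : content g `<=` [set y | content (f * g) (f`_i * y)].
  move=> _ [x fx [y gy <-]].
  suff /(_ x fx) : content f `<=` [set x | content (f * g) (x * y)] by [].
  apply: content_sub => [|i]; last exact: sub.
  have [c0 cD _] := content_ideal (f * g).
  split=> [|u v|a u] /=; first by rewrite mul0r.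
    by rewrite mulrDl; exact: cD.
  by rewrite -mulrA; exact: cM.
apply: content_sub => [|j]; last exact: H.
have [c0 cD _] := content_ideal (f * g).
split=> [|u v|a u] /=; first by rewrite mulr0.
  by rewrite mulrDr; exact: cD.
by rewrite mulrCA; exact: cM.
Qed.

Lemma coefs_mul_ideal J f g m n :
  is_ideal J -> (size f <= m)%N -> (size g <= n)%N ->
  (forall k, J (f * g)`_k) ->
  forall i, exists N, forall j, J (f`_i ^+ N * g`_j).
Proof.
move=> idJ; have [J0 JD JM] := idJ.
have [s] := ubnP (m + n); elim: s => // s IHs in m n f g *.
case: m => [|m] lt_mn_s szf szg Jfg i.
  exists 1%N => j.
  by rewrite nth_default ?(leq_trans szf) // expr1 mul0r.
case: n => [|n] in lt_mn_s szg *.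
  exists 0%N => j.
  by rewrite [g`_j]nth_default ?(leq_trans szg) // mulr0.
set a := f`_m; set b := g`_n.
have split_top (p : {poly R}) k :
    (size p <= k.+1)%N -> p = take_poly k p + p`_k *: 'X^k.
  move=> szp; apply/polyP => l; rewrite coefD coef_take_poly coefZ coefXn.
  have [l_lt|l_gt|->] := ltngtP l k; rewrite ?mulr0 ?addr0 ?mulr1 ?add0r //.
  by rewrite nth_default // (leq_trans szp).
have Jab : J (a * b).
  (* Any other index pair summing to [m + n] exceeds [m] in [f] or [n] in [g], so only one term
     survives. *)
  suff -> : a * b = (f * g)`_(m + n) by [].
  rewrite coefM (bigD1 (inord m)) //= inordK ?leq_addr // ?ltnS ?leq_addr //.
  rewrite addKn big1 ?addr0 // => k neq_km.
  have [lt_km|gt_km|eq_km] := ltngtP k m.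
  - by rewrite [g`_(_ - _)]nth_default ?mulr0 // (leq_trans szg) // ltn_subRL
      ltn_add2r.
  - by rewrite nth_default ?mul0r // (leq_trans szf).
  - by case/eqP: neq_km; apply: val_inj; rewrite /= inordK ?ltnS ?leq_addr.
have lower i' : exists N, forall j, J (f`_i' ^+ N * (a * g`_j)).
  have [|||k|N JN] := IHs m.+1 n f (a *: take_poly n g) _ _ _ _ i'.
  - by rewrite -ltnS -addnS.
  - by [].
  - exact: leq_trans (size_scale_leq _ _) (size_take_poly _ _).
  - rewrite (_ : f * _ = a *: (f * g) - (a * b) *: (f * 'X^n)).
      rewrite coefB !coefZ; apply: ideal_sub => //; first exact: JM.
      by rewrite mulrC; exact: JM.
    rewrite {2}(split_top _ _ szg) mulrDr scalerDr -!scalerAr scalerA.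
    by rewrite addrK.
  exists N => j; have := JN j; rewrite coefZ coef_take_poly.
  have [//|j_gt|->] := ltngtP j n => _; last by exact: JM.
  by rewrite [g`_j]nth_default ?(leq_trans szg) // !mulr0.
have [i_lt|i_gt|->] := ltngtP i m; last first.
- have [N JN] := lower m; exists N.+1 => j.
  by rewrite exprSr -mulrA; exact: JN.
- exists 1%N => j.
  by rewrite nth_default ?(leq_trans szf) // expr1 mul0r.
have [N JN] := lower i.
have [|||k|N' JN'] := IHs m n.+1 (take_poly m f) (f`_i ^+ N *: g) _ _ _ _ i.
- by [].
- exact: size_take_poly.
- exact: leq_trans (size_scale_leq _ _) szg.
- rewrite (_ : _ * _ = f`_i ^+ N *: (f * g) - (f`_i ^+ N * a) *: (g * 'X^m)).
    rewrite coefB !coefZ coefMXn; apply: ideal_sub => //; first exact: JM.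
    by case: ifP => _; rewrite ?mulr0 // -mulrA; exact: JN.
  rewrite {4}(split_top _ _ szf) mulrDl scalerDr -scalerAr -scalerAl scalerA.
  by rewrite ['X^m * g]mulrC addrK.
exists (N' + N)%N => j.
by have := JN' j; rewrite coefZ coef_take_poly i_lt exprD mulrA.
Qed.

Lemma content_mul_unit_coef f g i u j :
  f`_i * u = 1 -> content (f * g) g`_j.
Proof.
move=> fiu; have [_ _ cM] := content_ideal (f * g).
have [N /(_ j) cN] := coefs_mul_ideal (content_ideal (f * g)) (leqnn (size f))
  (leqnn (size g)) (@content_coef (f * g)) i.
have := cM (u ^+ N) _ cN.
by rewrite mulrA -exprMn [u * _]mulrC fiu expr1n mul1r.
Qed.

(** * Maximal ideals and units of a local ring *)

Lemma proper_ideal_sub_maximal I :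
  is_ideal I -> ~ I 1 -> exists J, maximal_ideal J /\ I `<=` J.
Proof.
move=> idI I1.
(* Adjoining [I] makes the empty union, required by [Zorn_bigcup], admissible. *)
pose P (X : set R) := is_ideal (I `|` X) /\ ~ (I `|` X) 1.
have [F FP Ftot|X [[idX X1] maxX]] := @Zorn_bigcup _ P.
  (* Two elements of the union lie in a common [I]|[X] with [X] in the chain, or both in [I]; the
     latter covers the empty chain. *)
  have sup u v : (I `|` \bigcup_(X in F) X) u -> (I `|` \bigcup_(X in F) X) v ->
      (I u /\ I v) \/ exists2 X, F X & (I `|` X) u /\ (I `|` X) v.
    move=> [Iu|[X FX Xu]] [Iv|[Y FY Yv]]; first by left.
    - by right; exists Y => //; split; [left|right].
    - by right; exists X => //; split; [right|left].
    right; have [XY|YX] := Ftot _ _ FX FY.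
      by exists Y => //; split; right => //; exact: XY.
    by exists X => //; split; right => //; exact: YX.
  have incl X : F X -> I `|` X `<=` I `|` \bigcup_(X in F) X.
    by move=> FX x [Ix|Xx]; [left|right; exists X].
  have [I0 ID IM] := idI.
  split=> [|[//|[X FX X1]]]; last by have [_] := FP X FX; apply; right.
  split=> [|u v Uu Uv|a u Uu]; first by left.
    have [[Iu Iv]|[X FX [Xu Xv]]] := sup _ _ Uu Uv; first by left; exact: ID.
    by apply: (incl _ FX); have [[_ XD _] _] := FP X FX; exact: XD.
  have [[Iu _]|[X FX [Xu _]]] := sup _ _ Uu Uu; first by left; exact: IM.
  by apply: (incl _ FX); have [[_ _ XM] _] := FP X FX; exact: XM.
exists (I `|` X); split; last by left.
split=> // [|J idJ XJ]; first by apply/eqP => XT; apply: X1; rewrite XT.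
have [J1|J1] := pselect (J 1).
  right; rewrite -subTset => x _; have [_ _ JM] := idJ.
  by rewrite -(mulr1 x); exact: JM.
left; rewrite eqEsubset; split=> // x Jx; right; apply: contrapT => Xx.
apply: (maxX J).
  by split=> [y Xy|JX]; [apply: XJ; right|apply: Xx; exact: JX].
have IJ : I `|` J = J by apply/setUidPr => y Iy; apply: XJ; left.
by split; rewrite IJ.
Qed.

(** Otherwise the multiples of [x] form a proper ideal, contained in a maximal ideal, which can only
    be [M]. *)
Lemma local_ring_unit (M : idealr R) x :
  local_ring M -> x \notin M -> exists y, x * y = 1.
Proof.
move=> [_ Mmax] Mx; apply: contrapT => Nx.
have [||J [/Mmax -> sub]] := @proper_ideal_sub_maximal [set x * y | y in setT].
- split=> [|_ _ [y _ <-] [z _ <-]|a _ [y _ <-]].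
  + by exists 0; rewrite ?mulr0.
  + by exists (y + z); rewrite ?mulrDr.
  + by exists (a * y); rewrite // mulrCA.
- by case=> y _ xy; apply: Nx; exists y.
by move/negP: Mx; apply; apply: sub; exists 1; rewrite ?mulr1.
Qed.

End Ideals.

(** * Descent along a module retraction *)

Lemma gaussian_retract (A R : comNzRingType) (iota : {rmorphism A -> R})
    (phi : R -> A) :
  (forall x y, phi (x + y) = phi x + phi y) ->
  (forall a x, phi (iota a * x) = a * phi x) ->
  (forall a, phi (iota a) = a) ->
  gaussian R -> gaussian A.
Proof.
move=> phiD phiZ phiK /gaussianP gaussR; apply/gaussianP => f g i j.
have [c0 cD cM] := content_ideal (f * g).
(* As [phi] is only [A]-linear, the preimage of [content (f * g)] need not be an ideal of [R]; [J]
   is the largest ideal inside it. It contains the coefficients [iota c] of the product, because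
   [phi (r * iota c) = c * phi r]. *)
pose J := [set x | forall r, content (f * g) (phi (r * x))].
have phi0 : phi 0 = 0 by rewrite -[0](rmorph0 iota) phiK.
have idJ : is_ideal J.
  split=> [r|x y Jx Jy r|a x Jx r]; first by rewrite mulr0 phi0.
    by rewrite mulrDr phiD; exact: cD.
  by rewrite mulrA; exact: Jx.
have Jfg k : J (map_poly iota f * map_poly iota g)`_k.
  move=> r; rewrite -rmorphM coef_map [r * _]mulrC phiZ [X in content _ X]mulrC.
  by apply: cM; exact: content_coef.
have := content_sub idJ Jfg (gaussR (map_poly iota f) (map_poly iota g) i j) 1.
by rewrite mul1r !coef_map -rmorphM phiK.
Qed.

(** * Gaussian trivial extensions *)

Section TrivExt.
Variables (A : comNzRingType) (E : lmodType A).

Definition triv_ext_inl (a : A) : triv_ext E := (a, 0).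

Fact triv_ext_inl_zmod_morphism : zmod_morphism triv_ext_inl.
Proof. by move=> a b; congr pair; rewrite /= ?subr0. Qed.

Fact triv_ext_inl_monoid_morphism : monoid_morphism triv_ext_inl.
Proof. by split=> // a b; congr pair; rewrite /= !scaler0 addr0. Qed.

HB.instance Definition _ := GRing.isZmodMorphism.Build A (triv_ext E)
  triv_ext_inl triv_ext_inl_zmod_morphism.
HB.instance Definition _ := GRing.isMonoidMorphism.Build A (triv_ext E)
  triv_ext_inl triv_ext_inl_monoid_morphism.

Lemma gaussian_triv_ext_base : gaussian (triv_ext E) -> gaussian A.
Proof. exact: (@gaussian_retract _ _ triv_ext_inl fst). Qed.

Lemma triv_ext_unit (x : triv_ext E) b :
  x.1 * b = 1 -> exists y : triv_ext E, x * y = 1.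
Proof.
(* As [E] squares to zero, the geometric series for the inverse of [a + e] stops at [b - b^2 e]. *)
case: x => a e /= ab; exists (b, - (b * b) *: e).
congr pair => //=; rewrite scalerA mulrN mulrA ab mul1r -scalerDl addNr.
exact: scale0r.
Qed.

(** The dichotomy is what a local ring gives for [E = A / M]: elements outside [M] are units, and
    those in [M] kill [E]. *)
Lemma gaussian_triv_ext :
  (forall a, (exists b, a * b = 1) \/ (forall e : E, a *: e = 0)) ->
  gaussian A -> gaussian (triv_ext E).
Proof.
move=> unit_or_kill /gaussianP gaussA; apply/gaussianP => F G i j.
have [_ _ cM] := content_ideal (F * G).
have [[k [b Fkb]]|nF] := pselect (exists k, exists b, (F`_k).1 * b = 1).
  have [y Fky] := triv_ext_unit Fkb.
  by apply: cM; exact: content_mul_unit_coef Fky.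
have [[k [b Gkb]]|nG] := pselect (exists k, exists b, (G`_k).1 * b = 1).
  have [y Gky] := triv_ext_unit Gkb.
  rewrite [F`_i * _]mulrC; apply: cM; rewrite mulrC.
  exact: content_mul_unit_coef Gky.
have killF k (e : E) : (F`_k).1 *: e = 0.
  by case: (unit_or_kill (F`_k).1) => // -[b Fkb]; case: nF; exists k, b.
have killG k (e : E) : (G`_k).1 *: e = 0.
  by case: (unit_or_kill (G`_k).1) => // -[b Gkb]; case: nG; exists k, b.
pose fst_ext (x : triv_ext E) : A := x.1.
pose f := map_poly fst_ext F; pose g := map_poly fst_ext G.
have fE k : f`_k = (F`_k).1 by rewrite coef_map_id0.
have gE k : g`_k = (G`_k).1 by rewrite coef_map_id0.
(* Both cross terms in [E] vanish, so products of coefficients see only the first components. *)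
have FGij k l : F`_k * G`_l = triv_ext_inl (f`_k * g`_l).
  by rewrite fE gE; congr pair; rewrite /= killF killG addr0.
have FG : F * G = map_poly triv_ext_inl (f * g).
  apply/polyP => k; rewrite coef_map !coefM raddf_sum.
  by apply: eq_bigr => l _; exact: FGij.
rewrite FGij FG.
(* The contraction to [A] of the content of [F * G]; it contains the coefficients of [f * g], hence
   by [gaussA] also [f]_i * g[_j]. *)
pose J := [set a | content (map_poly triv_ext_inl (f * g)) (triv_ext_inl a)].
apply: (content_sub (J := J)) (gaussA f g i j).
  rewrite /J -FG; have [c0 cD _] := content_ideal (F * G).
  split=> [|u v|a u] /=; rewrite ?rmorph0 ?rmorphD ?rmorphM //.
    exact: cD.
  exact: cM.
by move=> k; rewrite /J /= -(coef_map triv_ext_inl); exact: content_coef.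
Qed.

End TrivExt.

Lemma quot_scale_mem (A : comNzRingType) (M : idealr A) a
    (e : {ideal_quot M}) :
  a \in M -> a *: e = 0.
Proof.
move=> Ma; have pia : \pi_{ideal_quot M}%qT a = 0.
  apply/eqP; rewrite -(rmorph0 \pi_{ideal_quot M}%qT).
  by rewrite -Quotient.idealrBE subr0.
by rewrite [LHS](_ : _ = \pi_{ideal_quot M}%qT a * e) // pia mul0r.
Qed.

Theorem theorem2p1 :
  (forall (R : comNzRingType) (P : {pred R}) (A : subComNzRingType P),
     subring_retract A -> gaussian R -> gaussian A)
  /\
  (forall (A : comNzRingType) (M : idealr A),
     local_ring M ->
     (gaussian (triv_ext {ideal_quot M}) <-> gaussian A)).
Proof.
split=> [R P A [phi [phiD phiZ phiK]]|A M locM].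
  exact: (@gaussian_retract A R val phi).
split; first exact: gaussian_triv_ext_base.
apply: gaussian_triv_ext => a; have [Ma|Ma] := boolP (a \in M).
  by right=> e; exact: quot_scale_mem.
by left; exact: local_ring_unit locM Ma.
Qed.
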